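(* There exist absolute constants $c_0, c_1 > 0$ such that for every finite field $\mathbb{F}$, with $q = |\mathbb{F}|$ elements, and every integer $n \geq 1$: if $K \subseteq \mathbb{F}^n$ is a Kakeya set in $\mathbb{F}^n$, then $|K| \geq c_0 \cdot (c_1 \cdot q)^n$.
   Context: Let $\mathbb{F}$ be a finite field. A set $K \subseteq \mathbb{F}^n$ is called a Kakeya set in $\mathbb{F}^n$ if for every $\mathbf{b} \in \mathbb{F}^n$ there exists a point $\mathbf{a} \in \mathbb{F}^n$ such that for every $t \in \mathbb{F}$ the point $\mathbf{a} + t\cdot\mathbf{b}$ belongs to $K$. *)

(* Defs.v *)
From HB Require Import structures.
From mathcomp Require Import all_boot all_order all_algebra.
From mathcomp Require Import reals.

Set Implicit Arguments.
Unset Strict Implicit.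
Unset Printing Implicit Defensive.

Import Order.TTheory GRing.Theory Num.Theory.

Local Open Scope ring_scope.

(* The direction b ranges over all vectors, including 0, for which the
   condition only says that K is nonempty. *)
Definition kakeya_set (F : finFieldType) (n : nat) (K : {set 'rV[F]_n}) : Prop :=
  forall b : 'rV[F]_n, exists a : 'rV[F]_n, forall t : F, a + t *: b \in K.

(* Main.v *)
(* Saraf and Sudan's form of the polynomial method.  If #|K| 4^n < q^n, linear
   algebra gives a nonzero polynomial P, of degree less than q in each of the n
   variables, vanishing on K with multiplicity n: there are 'C(2n - 1, n) <= 4^n
   conditions per point.  Its restriction to a line contained in K has degree at
   most n (q - 1) but nq roots, so it vanishes, and hence the top homogeneous
   part of P vanishes at every direction b.  Having degree less than q in each
   variable, this top part is zero, a contradiction. *)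
Require Import Defs.
From HB Require Import structures.
From mathcomp Require Import all_boot all_order all_algebra.
From mathcomp Require Import reals.

Import Order.TTheory GRing.Theory Num.Theory.

Local Open Scope ring_scope.

Lemma leq_bin_exp2 n k : ('C(n, k) <= 2 ^ n)%N.
Proof.
elim: n k => [|n IHn] [|k] //=; first by rewrite bin0 expn_gt0.
by rewrite binS expnS mul2n -addnn leq_add.
Qed.

(** For positive [n], each coordinate is at most [n - 1], so these vectors inject into the tuples
    over ['I_n] of sum at most [n - 1], whose number does not depend on [q]. *)
Lemma card_bounded_degree q n :
  (#|[set j : {ffun 'I_n -> 'I_q} | \sum_i j i < n]| <= 4 ^ n)%N.
Proof.
case: n => [|m]; first by rewrite (leq_trans (max_card _)) // card_ffun !card_ord.
pose J := [set j : {ffun 'I_m.+1 -> 'I_q} | (\sum_i j i < m.+1)%N].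
pose f (j : {ffun 'I_m.+1 -> 'I_q}) := [tuple (inord (j i) : 'I_m.+1) | i < m.+1].
have leJ j i : j \in J -> (j i <= m)%N.
  by rewrite inE ltnS (bigD1 i) //= => /(leq_trans (leq_addr _ _)).
have f_inj : {in J &, injective f}.
  move=> j k Jj Jk eq_f; apply/ffunP => i; apply: val_inj => /=.
  have := congr1 (fun t => val (tnth t i)) eq_f.
  by rewrite !tnth_mktuple /= !inordK ?ltnS ?leJ.
rewrite -/J -(card_in_imset f_inj).
apply: (@leq_trans 'C(m.+1 + m, m.+1)); last first.
  rewrite (leq_trans (leq_bin_exp2 _ _)) //.
  by rewrite (erefl : 4 = 2 ^ 2)%N -expnM leq_exp2l // mul2n -addnn leq_add2l.
rewrite -card_partial_ord_partitions; apply/subset_leq_card/subsetP => _ /imsetP[j Jj ->].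
rewrite inE big_tuple.
under eq_bigr => i _ do rewrite tnth_mktuple inordK ?ltnS ?leJ //.
by move: Jj; rewrite inE.
Qed.

Lemma linear_system_nontrivial (F : fieldType) (E Y : finType) (S : {set Y})
    (A : E -> Y -> F) : (#|S| < #|E|)%N ->
  exists c : E -> F, (exists e, c e != 0) /\
    forall y, y \in S -> \sum_e c e * A e y = 0.
Proof.
move=> ltSE.
pose M : 'M[F]_(#|E|, #|S|) := \matrix_(i, j) A (enum_val i) (enum_val j).
have : kermx M != 0.
  by rewrite kermx_eq0 /row_free neq_ltn (leq_ltn_trans (rank_leq_col M)).
case/rowV0Pn => v /sub_kermxP vM0 v_neq0.
exists (fun e => v 0 (enum_rank e)); split.
  by case/rV0Pn: v_neq0 => i vi; exists (enum_val i); rewrite enum_valK.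
move=> y Sy; have /matrixP/(_ 0 (enum_rank_in Sy y)) := vM0.
rewrite !mxE (reindex_onto enum_rank enum_val) => [|i _]; last exact: enum_valK.
move=> vMy0; rewrite -[RHS]vMy0; apply: eq_big => [e|e _].
  by rewrite enum_rankK eqxx.
by rewrite !mxE enum_rankK enum_rankK_in.
Qed.

(** The powers for distinct [t] are coprime, so their product, of degree [n * #|F|], divides [p]; a
    nonzero [p] would have size above that degree. *)
Lemma poly_multiple_roots_eq0 (F : finFieldType) (n : nat) (p : {poly F}) :
    (size p <= n * #|F|)%N ->
  (forall t, ('X - t%:P) ^+ n %| p) -> p = 0.
Proof.
move=> sz_p dvd_p; apply/eqP; apply: contraTT sz_p => p_neq0.
have dvd_prod (s : seq F) : uniq s -> (\prod_(t <- s) ('X - t%:P)) ^+ n %| p.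
  elim: s => [_|t s IHs /= /andP[s't Us]]; first by rewrite big_nil expr1n dvd1p.
  rewrite big_cons exprMn Gauss_dvdp ?dvd_p ?IHs //.
  by rewrite coprimep_expl // coprimep_expr // coprimep_sym coprimep_XsubC
             root_prod_XsubC.
rewrite -ltnNge; apply: leq_trans (dvdp_leq p_neq0 (dvd_prod _ (enum_uniq F))).
set P := \prod_(t <- _) _.
have P_monic : P ^+ n \is monic by rewrite rpredX // monic_prod_XsubC.
rewrite -[size _]prednK ?size_poly_gt0 ?monic_neq0 //.
by rewrite size_exp size_prod_XsubC cardE mulnC.
Qed.

Section ReducedPolynomials.

Variables (F : finFieldType) (n : nat).

(* Exponent vectors; a function [c : mon -> F] stands for the polynomial
   [\sum_e c e X^e]. *)
Local Notation mon := {ffun 'I_n -> 'I_#|F|}.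

Definition mdegree (e : mon) : nat := \sum_i e i.

(** The Hasse derivative: the coefficient of [Y^j] in [P(x + Y)]. Unlike iterated derivatives, it
    detects multiplicity in every characteristic. *)
Definition hasse (c : mon -> F) (j : mon) (x : 'rV[F]_n) : F :=
  \sum_e c e * \prod_i (x 0 i ^+ (e i - j i) *+ 'C(e i, j i)).

(** A general [s] allows expanding the same restriction to a line around any of its points, with [s]
    being ['X] or ['X - t%:P]. *)
Lemma taylor_hasse (c : mon -> F) (x b : 'rV[F]_n) (s : {poly F}) :
  \sum_e (c e)%:P * \prod_i ((x 0 i)%:P + (b 0 i)%:P * s) ^+ e i =
  \sum_j (hasse c j x * \prod_i b 0 i ^+ j i) *: s ^+ mdegree j.
Proof.
have expand (e : mon) i : ((x 0 i)%:P + (b 0 i)%:P * s) ^+ e i =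
    \sum_(k < #|F|) (x 0 i ^+ (e i - k) *+ 'C(e i, k) * b 0 i ^+ k) *: s ^+ k.
  (* The terms added beyond [e i] have zero binomial; a common range for [k] lets the product
     distribute into a sum over [mon]. *)
  rewrite exprDn (big_ord_widen _ (fun k => (x 0 i)%:P ^+ (e i - k) *
    ((b 0 i)%:P * s) ^+ k *+ 'C(e i, k)) (ltn_ord (e i))) big_mkcond /=.
  apply: eq_bigr => k _; rewrite ltnS; case: leqP => [_|lt_ek].
    rewrite exprMn -!rmorphXn /= mulrA -polyCM mul_polyC scalerMnl.
    by rewrite mulrnAl.
  by rewrite bin_small // mulr0n mul0r scale0r.
under eq_bigr => e _.
  under eq_bigr => i _ do rewrite expand.
  rewrite bigA_distr_bigA mulr_sumr /=; over.
rewrite exchange_big /=; apply: eq_bigr => j _.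
rewrite /hasse mulr_suml scaler_suml; apply: eq_bigr => e _.
rewrite scaler_prod prodrXr mul_polyC scalerA.
by rewrite big_split /= mulrA.
Qed.

(** If [c e != 0] and [e] is not [j], some [e i < j i] makes a binomial vanish: otherwise [j <= e]
    coordinatewise, and the degree bounds force equality. *)
Lemma hasse_top (c : mon -> F) (d : nat) (j : mon) (x : 'rV[F]_n) :
    (forall e, c e != 0 -> (mdegree e <= d)%N) -> (d <= mdegree j)%N ->
  hasse c j x = c j.
Proof.
move=> c_le le_dj; rewrite /hasse (bigD1 j) //= big1 => [|i _]; last first.
  by rewrite subnn expr0 binn.
rewrite mulr1 big1 ?addr0 // => e neq_ej.
have [->|/c_le le_ed] := eqVneq (c e) 0; first by rewrite mul0r.
have [/forallP le_ji|] := boolP [forall i, j i <= e i]%N; last first.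
  rewrite negb_forall => /existsP[i]; rewrite -ltnNge => lt_ei.
  by rewrite (bigD1 i) //= bin_small // mulr0n mul0r mulr0.
have leif_ji i : true -> (j i <= e i ?= iff (j i == e i :> nat))%N.
  by move=> _; split.
have [_] := leqif_sum leif_ji; rewrite eqn_leq (leq_trans le_ed le_dj) andbT.
have -> : (\sum_i j i <= \sum_i e i)%N by apply: leq_sum.
move/esym/forall_inP => eq_je; case/eqP: neq_ej.
by apply/ffunP => i; apply/val_inj/esym/eqP/eq_je.
Qed.

Lemma reduced_poly_eq0 (c : mon -> F) :
    (forall b : 'rV[F]_n, \sum_e c e * \prod_i b 0 i ^+ e i = 0) ->
  forall e, c e = 0.
Proof.
(* The inverse of the Vandermonde matrix of the points of F yields functionals
   dual to the powers 0, ..., q - 1; their products extract the coefficient [c e]. *)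
move=> c0 e.
pose q := #|F|; pose pt : 'rV[F]_q := \row_k enum_val k.
pose V := Vandermonde q pt.
have V_unit : V \in unitmx.
  rewrite unitmxE det_Vandermonde unitfE; apply/prodf_neq0 => i _.
  apply/prodf_neq0 => j lt_ij; rewrite !mxE subr_eq0.
  by rewrite (inj_eq enum_val_inj) neq_ltn lt_ij orbT.
have dual (k l : 'I_q) : \sum_t enum_val t ^+ k * invmx V t l = (k == l)%:R.
  have /matrixP/(_ k l) := mulmxV V_unit; rewrite !mxE => <-.
  by apply: eq_bigr => t _; rewrite !mxE.
(* Here [g : mon] indexes the points of [F^n] through [enum_val]. *)
have dual_prod (f : mon) : \sum_(g : mon) (\prod_i invmx V (g i) (e i)) *
    (c f * \prod_i (\row_k (enum_val (g k) : F)) 0 i ^+ f i) = c f * (f == e)%:R.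
  have -> : (f == e)%:R = \prod_i \sum_t invmx V t (e i) * enum_val t ^+ f i.
    under eq_bigr => i _ do
      (under eq_bigr => t _ do rewrite mulrC; rewrite dual).
    have [->|/eqP neq_fe] := eqVneq f e.
      by rewrite big1 // => i _; rewrite eqxx.
    have /existsP[i neq_i] : [exists i, f i != e i].
      rewrite -negb_forall; apply/negP => /forallP eq_fe.
      by apply: neq_fe; apply/ffunP => i; apply/eqP.
    by rewrite (bigD1 i) //= (negPf neq_i) mul0r.
  rewrite bigA_distr_bigA mulr_sumr; apply: eq_bigr => g _.
  rewrite mulrCA -big_split; congr (_ * _).
  by apply: eq_bigr => i _; rewrite mxE.
have : \sum_(g : mon) (\prod_i invmx V (g i) (e i)) *
    \sum_f c f * \prod_i (\row_i (enum_val (g i) : F)) 0 i ^+ f i = 0.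
  by apply: big1 => g _; rewrite c0 mulr0.
under eq_bigr => g _ do rewrite mulr_sumr.
rewrite exchange_big /= (bigD1 e) //= [X in _ + X]big1 => [|f neq_fe].
    by rewrite addr0 dual_prod eqxx mulr1.
by rewrite dual_prod (negPf neq_fe) mulr0.
Qed.

Lemma mdegree_lt (e : mon) : (0 < n)%N -> (mdegree e < n * #|F|)%N.
Proof.
move=> n_gt0; have F_gt0 : (0 < #|F|)%N by apply/card_gt0P; exists 0.
apply: (@leq_ltn_trans (n * #|F|.-1)); last by rewrite ltn_pmul2l // prednK.
rewrite -[n in (n * _)%N]card_ord -sum_nat_const.
by apply: leq_sum => i _; rewrite -ltnS prednK.
Qed.

Lemma kakeya_card (K : {set 'rV[F]_n}) :
  (0 < n)%N -> kakeya_set K -> (#|F| ^ n <= #|K| * 4 ^ n)%N.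
Proof.
move=> n_gt0 kakeyaK; rewrite leqNgt; apply/negP => lt_K.
pose J := [set j : mon | (mdegree j < n)%N].
(* Fewer equations, one per point of [K] and order in [J], than unknown coefficients. *)
have ltKJ : (#|setX K J| < #|mon|)%N.
  rewrite cardsX card_ffun !card_ord; apply: leq_ltn_trans lt_K.
  by rewrite leq_mul2l card_bounded_degree orbT.
pose A (e : mon) (y : 'rV[F]_n * mon) :=
  \prod_i (y.1 0 i ^+ (e i - y.2 i) *+ 'C(e i, y.2 i)).
have [c [[e1 ce1] c0]] := linear_system_nontrivial _ _ _ _ A ltKJ.
have hasse0 j x : x \in K -> (mdegree j < n)%N -> hasse c j x = 0.
  by move=> Kx lt_jn; apply: (c0 (x, j)); rewrite !inE Kx.
case: (@arg_maxnP _ e1 (fun e => c e != 0) mdegree ce1) => e0 ce0 max_e0.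
pose top e := if mdegree e == mdegree e0 then c e else 0.
suff /(_ e0) : forall e, top e = 0 by rewrite /top eqxx; apply/eqP.
apply: reduced_poly_eq0 => b; have [a Kab] := kakeyaK b.
pose p := \sum_e (c e)%:P * \prod_i ((a 0 i)%:P + (b 0 i)%:P * 'X) ^+ e i.
have p_at0 : p = \sum_j (hasse c j a * \prod_i b 0 i ^+ j i) *: 'X^(mdegree j).
  exact: taylor_hasse.
have p0 : p = 0.
  apply: (poly_multiple_roots_eq0 F n).
    rewrite p_at0; apply: (leq_trans (size_sum _ _ _)).
    apply/bigmax_leqP => j _; apply: (leq_trans (size_scale_leq _ _)).
    by rewrite size_polyXn mdegree_lt.
  (* Recentred at [a + t *: b], a point of [K], the expansion loses its terms of order below [n]. *)
  move=> t; have -> : p = \sum_e (c e)%:P *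
      \prod_i (((a + t *: b) 0 i)%:P + (b 0 i)%:P * ('X - t%:P)) ^+ e i.
    apply: eq_bigr => e _; congr (_ * _); apply: eq_bigr => i _.
    by rewrite !mxE polyCD polyCM mulrBr [t%:P * _]mulrC addrACA subrr addr0.
  rewrite taylor_hasse; apply: (big_ind (fun r => _ %| r)) => [|r s|j _].
    exact: dvdp0.
    exact: dvdp_add.
  have [lt_jn|le_nj] := ltnP (mdegree j) n.
    by rewrite hasse0 // mul0r scale0r dvdp0.
  by rewrite -mul_polyC dvdp_mull // dvdp_exp2l.
(* By [hasse_top], the coefficient of [p] in the maximal degree is the value of [top] at [b]. *)
have := congr1 (fun r : {poly F} => r`_(mdegree e0)) p0.
rewrite p_at0 coef0 coef_sum => p_d0.
rewrite -[RHS]p_d0; apply: eq_bigr => j _.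
rewrite coefZ coefXn /top eq_sym; case: eqP => [eq_d|_]; last by rewrite mul0r mulr0.
by rewrite (@hasse_top _ (mdegree e0)) ?mulr1 // eq_d.
Qed.

End ReducedPolynomials.

Theorem theorem2 (R : realType) :
  exists c0 c1 : R, [/\ 0 < c0, 0 < c1 &
    forall (F : finFieldType) (n : nat) (K : {set 'rV[F]_n}),
      (1 <= n)%N -> kakeya_set K ->
      c0 * (c1 * #|F|%:R) ^+ n <= #|K|%:R].
Proof.
exists 1, 4^-1; split=> [||F n K n_gt0 /(kakeya_card _ _ _ n_gt0) leK].
- exact: ltr01.
- by rewrite invr_gt0 ltr0n.
rewrite mul1r exprMn exprVn mulrC ler_pdivrMr ?exprn_gt0 ?ltr0n //.
by rewrite -!natrX -natrM ler_nat.
Qed.
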